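(* Every finite simple graph with $n$ vertices and $m$ edges admits a RAC drawing on the integer grid with curve complexity $6$ (i.e. every edge is a polyline with at most $6$ bends) and area $O(n^{11/4})$, and the drawing can be computed in time $O(n+m)$. Here the implied constants are absolute.
   Context: A polyline drawing of a graph $G$ on the integer grid maps the vertices of $G$ to distinct points of $\mathbb{Z}^2$ and each edge to a polyline (a simple curve made of finitely many straight-line segments) joining the points of its two endvertices, such that all bends (points where two consecutive segments of an edge meet) are also points of $\mathbb{Z}^2$. As is standard for graph drawings, an edge does not pass through any vertex other than its endvertices, and segments of distinct edges do not overlap, i.e. two distinct edges have only finitely many common points, each of which is a common endvertex or a crossing. A RAC drawing (Right Angle Crossing drawing) is such a drawing in which any two crossing edges are orthogonal, i.e. wherever a segment of one edge crosses a segment of another edge, the two segments are perpendicular. The curve complexity of a polyline drawing is the maximum number of bends per edge; ''with curve complexity $k$'' as an upper bound means that every edge has at most $k$ bends. The area of a drawing is the size (width times height) of the smallest axis-aligned box enclosing the drawing on the integer grid on which the vertices and bends are located. Running time is counted in the usual unit-cost model, in which an arithmetic operation on, or the output of, a coordinate takes constant time; the graph is given by its vertices and its edge list. *)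

(* Defs.v *)
From mathcomp Require Import all_boot all_order all_algebra.
From mathcomp Require Import all_classical all_reals all_analysis.

Set Implicit Arguments.
Unset Strict Implicit.
Unset Printing Implicit Defensive.

Import Order.TTheory GRing.Theory Num.Theory.
Local Open Scope ring_scope.

Record sgraph (n : nat) := SGraph {
  adj :> rel 'I_n;
  adj_sym : symmetric adj;
  adj_irrefl : irreflexive adj }.

Definition edges n (G : sgraph n) : {set {set 'I_n}} :=
  [set [set e.1; e.2]%SET | e in [pred e : 'I_n * 'I_n | G e.1 e.2]]%SET.

(* Every edge is listed exactly once, in one of its two orientations. *)
Definition edge_list n (G : sgraph n) (es : seq ('I_n * 'I_n)) : Prop :=
  perm_eq [seq [set e.1; e.2]%SET | e <- es] (enum (edges G)).

Notation gpoint := (int * int)%type.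

Section Polylines.
Variable R : realType.

Definition embed (p : gpoint) : R * R := (p.1%:~R, p.2%:~R).

(* The polyline with corners s_0, ..., s_k is the curve on [0, k] whose value
   at i + t, for i < k and 0 <= t <= 1, is seg_point s i t. *)
Definition seg_point (s : seq gpoint) (i : nat) (t : R) : R * R :=
  let p := embed (nth (0, 0) s i) in
  let q := embed (nth (0, 0) s i.+1) in
  ((1 - t) * p.1 + t * q.1, (1 - t) * p.2 + t * q.2).

Definition curve (s : seq gpoint) : set (R * R) :=
  fun z => exists (i : nat) (t : R),
    [/\ (i.+1 < size s)%N, 0 <= t <= 1 & z = seg_point s i t].

(* Injectivity of that parametrization. *)
Definition simple_polyline (s : seq gpoint) : Prop :=
  forall (i j : nat) (t u : R),
    (i.+1 < size s)%N -> (j.+1 < size s)%N -> 0 <= t <= 1 -> 0 <= u <= 1 ->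
    seg_point s i t = seg_point s j u -> i%:R + t = j%:R + u.

Definition seg_interior (s : seq gpoint) (i : nat) : set (R * R) :=
  fun z => exists t : R,
    [/\ (i.+1 < size s)%N, 0 < t < 1 & z = seg_point s i t].

(* Overlapping segments also satisfy this; drawings exclude them because two
   distinct edges have only finitely many common points. *)
Definition segs_cross (s : seq gpoint) (i : nat) (s' : seq gpoint) (j : nat)
    (z : R * R) : Prop :=
  seg_interior s i z /\ seg_interior s' j z.

End Polylines.

Definition direction (s : seq gpoint) (i : nat) : gpoint :=
  let p := nth (0, 0) s i in let q := nth (0, 0) s i.+1 in
  (q.1 - p.1, q.2 - p.2).

Definition perpendicular (v w : gpoint) : Prop := v.1 * w.1 + v.2 * w.2 = 0.

(* bends D u v lists the bends of the edge uv in order from u to v; its values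
   at non-adjacent pairs are irrelevant. *)
Record drawing (n : nat) := Drawing {
  vpos : 'I_n -> gpoint;
  bends : 'I_n -> 'I_n -> seq gpoint }.

Definition route n (D : drawing n) (u v : 'I_n) : seq gpoint :=
  vpos D u :: rcons (bends D u v) (vpos D v).

Definition distinct_edges n (G : sgraph n) (u v x y : 'I_n) : Prop :=
  [/\ G u v, G x y & [set u; v]%SET <> [set x; y]%SET].

Definition common_endvertex (R : realType) n (D : drawing n) (u v x y : 'I_n)
    (z : R * R) : Prop :=
  exists w : 'I_n,
    [/\ w \in [:: u; v], w \in [:: x; y] & z = embed R (vpos D w)].

Definition grid_drawing (R : realType) n (G : sgraph n) (D : drawing n) : Prop :=
  [/\ injective (vpos D),
      forall u v, G u v -> bends D v u = rev (bends D u v),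
      forall u v, G u v -> simple_polyline R (route D u v),
      forall u v w, G u v -> curve (route D u v) (embed R (vpos D w)) ->
        w \in [:: u; v]
    & forall u v x y, distinct_edges G u v x y ->
        let common : set (R * R) :=
          fun z => curve (route D u v) z /\ curve (route D x y) z in
        finite_set common /\
        forall z, common z ->
          common_endvertex D u v x y z \/
          exists i j, segs_cross (route D u v) i (route D x y) j z].

Definition rac_drawing (R : realType) n (G : sgraph n) (D : drawing n) : Prop :=
  grid_drawing R G D /\
  forall u v x y, distinct_edges G u v x y ->
    forall (i j : nat) (z : R * R),
      segs_cross (route D u v) i (route D x y) j z ->
      perpendicular (direction (route D u v) i) (direction (route D x y) j).

Definition curve_complexity n (G : sgraph n) (D : drawing n) : nat :=
  \max_(e : 'I_n * 'I_n | G e.1 e.2) size (bends D e.1 e.2).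

Definition extent (s : seq int) : int :=
  \big[Order.max/head 0 s]_(x <- s) x - \big[Order.min/head 0 s]_(x <- s) x.

Definition corners n (G : sgraph n) (D : drawing n) : seq gpoint :=
  [seq vpos D u | u <- enum 'I_n] ++
  flatten [seq bends D e.1 e.2 | e <- enum {: 'I_n * 'I_n} & G e.1 e.2].

(* Segments lie in the convex hull of their ends, so the bounding box of the
   drawing is that of its vertices and bends. *)
Definition area n (G : sgraph n) (D : drawing n) : int :=
  extent [seq p.1 | p <- corners G D] * extent [seq p.2 | p <- corners G D].

(* Unit-cost random access machine, as a structured language: finitely many
   integer registers per program, an integer-addressed integer memory, and an
   output tape. Every operation on integers, memory access, assignment, test
   and output costs 1. *)
Inductive binop := Add | Sub | Mul | Div | Leq.

Inductive expr :=
| Const of int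
| Reg of nat
| Fetch of expr
| Op of binop & expr & expr.

Inductive cmd :=
| Skip
| Assign of nat & expr
| Store of expr & expr
| Print of expr
| Seq of cmd & cmd
| If of expr & cmd & cmd
| While of expr & cmd.

Record state := State {
  regs : nat -> int;
  memory : int -> int;
  out : seq int }.

Definition upd (T : eqType) (f : T -> int) (a : T) (x : int) : T -> int :=
  fun b => if b == a then x else f b.

(* Div is Euclidean division by the library's convention, with x / 0 = 0. *)
Definition eval_op (o : binop) (x y : int) : int :=
  match o return int with
  | Add => x + y
  | Sub => x - y
  | Mul => x * y
  | Div => divz x y
  | Leq => if x <= y then 1 else 0
  end.

Fixpoint eval (s : state) (e : expr) : int :=
  match e with
  | Const x => x
  | Reg r => regs s r
  | Fetch a => memory s (eval s a)
  | Op o e1 e2 => eval_op o (eval s e1) (eval s e2)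
  end.

Fixpoint cost (e : expr) : nat :=
  match e with
  | Const _ | Reg _ => 1
  | Fetch a => (cost a).+1
  | Op _ e1 e2 => (cost e1 + cost e2).+1
  end.

(* exec c s t s': started in s, the program c halts in s' after t steps.
   A test succeeds when its value is nonzero. *)
Inductive exec : cmd -> state -> nat -> state -> Prop :=
| ExecSkip s : exec Skip s 1 s
| ExecAssign s r e :
    exec (Assign r e) s (cost e).+1
      (State (upd (regs s) r (eval s e)) (memory s) (out s))
| ExecStore s a e :
    exec (Store a e) s (cost a + cost e).+1
      (State (regs s) (upd (memory s) (eval s a) (eval s e)) (out s))
| ExecPrint s e :
    exec (Print e) s (cost e).+1
      (State (regs s) (memory s) (rcons (out s) (eval s e)))
| ExecSeq s1 s2 s3 c1 c2 t1 t2 :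
    exec c1 s1 t1 s2 -> exec c2 s2 t2 s3 -> exec (Seq c1 c2) s1 (t1 + t2)%N s3
| ExecIfTrue s s' e c1 c2 t :
    eval s e != 0 -> exec c1 s t s' -> exec (If e c1 c2) s (cost e + t).+1 s'
| ExecIfFalse s s' e c1 c2 t :
    eval s e = 0 -> exec c2 s t s' -> exec (If e c1 c2) s (cost e + t).+1 s'
| ExecWhileStop s e c :
    eval s e = 0 -> exec (While e c) s (cost e).+1 s
| ExecWhileStep s1 s2 s3 e c t1 t2 :
    eval s1 e != 0 -> exec c s1 t1 s2 -> exec (While e c) s2 t2 s3 ->
    exec (While e c) s1 (cost e + t1 + t2).+1 s3.

(* The input is placed at addresses 0, 1, 2, ...; all else is initially 0. *)
Definition init_state (input : seq int) : state :=
  State (fun=> 0)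
        (fun a => if 0 <= a then nth 0 input `|a|%N else 0)
        [::].

Definition runs (P : cmd) (input : seq int) (t : nat) (output : seq int) : Prop :=
  exists2 s, exec P (init_state input) t s & out s = output.

(* n, m, then the two endvertices of each edge, with vertices 0, ..., n - 1. *)
Definition encode_graph n (es : seq ('I_n * 'I_n)) : seq int :=
  [:: n%:Z, (size es)%:Z &
      flatten [seq [:: (nat_of_ord e.1)%:Z; (nat_of_ord e.2)%:Z] | e <- es]].

Definition encode_point (p : gpoint) : seq int := [:: p.1; p.2].

(* The vertex positions, then for each listed edge (u, v) its number of bends
   and their coordinates in order from u to v. *)
Definition encode_drawing n (es : seq ('I_n * 'I_n)) (D : drawing n) : seq int :=
  flatten [seq encode_point (vpos D u) | u <- enum 'I_n] ++
  flatten [seq (size (bends D e.1 e.2))%:Z ::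
               flatten (map encode_point (bends D e.1 e.2)) | e <- es].

(* Main.v *)
Require Import Defs.
From mathcomp Require Import all_boot all_order all_algebra.
From mathcomp Require Import all_classical all_reals all_analysis.
From mathcomp Require Import ring lra zify.

Set Implicit Arguments.
Unset Strict Implicit.
Unset Printing Implicit Defensive.

Import Order.TTheory GRing.Theory Num.Theory.
Local Open Scope ring_scope.

(* Let k = 2n, d = (k, 1) and e = (-1, k). Vertex u is placed at
   V_u = (2u, 2u - 1), and an edge ab with a < b runs through
   V_a, q, q + d, q + d + 2e, q + 2e, q + e, V_b, where q = (2b, 2a).
   The four middle segments follow the perpendicular directions d and e. They
   lie on the lines ky - x = const and kx + y = const; modulo k^2 + 1 these
   constants determine each other and the point q of [0, k)^2. So lines of
   distinct edges are distinct, bends of one edge avoid the lines of the others,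
   and middle segments of distinct edges can only cross perpendicularly. The
   first segments of the edges going up from a stay in the strip
   2a - 1 <= y <= 2a, the last segments of the edges coming up to b stay in the
   strip 2b - 1 <= x <= 2b, and these fans meet nothing else. Five bends and a
   box of size O(n) x O(n) suffice, and every coordinate is an explicit formula
   in n, a, b, evaluated in constant time. *)

(** * Corners of the route of an edge *)

Definition vertex_pos (u : nat) : gpoint := (2 * u%:Z, 2 * u%:Z - 1).

Definition up_bends (n a b : nat) : seq gpoint :=
  [:: (2 * b%:Z, 2 * a%:Z);
      (2 * b%:Z + 2 * n%:Z, 2 * a%:Z + 1);
      (2 * b%:Z + 2 * n%:Z - 2, 2 * a%:Z + 4 * n%:Z + 1);
      (2 * b%:Z - 2, 2 * a%:Z + 4 * n%:Z);
      (2 * b%:Z - 1, 2 * a%:Z + 2 * n%:Z)].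

Definition up_route (n a b : nat) : seq gpoint :=
  vertex_pos a :: rcons (up_bends n a b) (vertex_pos b).

(** * Intersections of two routes *)

Section Geometry.
Variable R : realType.

(** Real [N], [A], [B] replace the natural numbers so that [lra] applies. In case 5 the factor
    [2 * A + 2 * N - 2 * B + 1] is positive for vertices of the drawing, so the last segment
    descends. *)
Definition up_point (N A B : R) (i : nat) (t : R) : R * R :=
  match i with
  | 0 => (2 * A + t * (2 * B - 2 * A), 2 * A - 1 + t)
  | 1 => (2 * B + t * (2 * N), 2 * A + t)
  | 2 => (2 * B + 2 * N - 2 * t, 2 * A + 1 + t * (4 * N))
  | 3 => (2 * B + 2 * N - 2 - t * (2 * N), 2 * A + 4 * N + 1 - t)
  | 4 => (2 * B - 2 + t, 2 * A + 4 * N - t * (2 * N))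
  | _ => (2 * B - 1 + t, 2 * B - 1 + (1 - t) * (2 * A + 2 * N - 2 * B + 1))
  end.

Lemma seg_point_up_route n a b i (t : R) : (i < 6)%N ->
  seg_point (up_route n a b) i t = up_point n%:R a%:R b%:R i t.
Proof.
rewrite /seg_point /embed => lti6.
do 6?[case: i lti6 => [|i] lti6] => //=;
  rewrite ?(rmorphB, rmorphD, rmorphM, rmorph1) /= -!pmulrn;
  congr pair; ring.
Qed.

(** Passes the integrality of vertex numbers on to linear arithmetic over [R]. *)
Lemma nat_gap (m p : nat) :
  [\/ m%:R = p%:R :> R, m%:R + 1 <= p%:R :> R | p%:R + 1 <= m%:R :> R].
Proof.
case: (ltngtP m p) => [h|h|h]; [apply: Or32|apply: Or33|by rewrite h; exact: Or31];
  by rewrite natr1 ler_nat.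
Qed.

Lemma up_point_inj (N A B t t' : R) i j : (i < 6)%N -> (j < 6)%N ->
  0 <= A -> A + 1 <= B -> B + 1 <= N -> 0 <= t <= 1 -> 0 <= t' <= 1 ->
  up_point N A B i t = up_point N A B j t' -> i%:R + t = j%:R + t'.
Proof.
move=> lti ltj A0 AB BN.
wlog leij : i j t t' lti ltj / (i <= j)%N.
  move=> wl ti tj e; case/orP: (leq_total i j) => h; first exact: wl e.
  by rewrite [RHS](wl _ _ _ _ ltj lti h tj ti (esym e)).
move=> /andP[t0 t1] /andP[t'0 t'1].
(* Products of a parameter with a coordinate are atoms for [lra], so their signs are supplied by
   hand. *)
have h1 : 0 <= t * (B - A) by apply: mulr_ge0; lra.
have h2 : 0 <= (1 - t) * (B - A) by apply: mulr_ge0; lra.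
have h3 : 0 <= t * (N - 1) by apply: mulr_ge0; lra.
have h4 : 0 <= (1 - t) * (N - 1) by apply: mulr_ge0; lra.
have h3' : 0 <= t' * (N - 1) by apply: mulr_ge0; lra.
have h4' : 0 <= (1 - t') * (N - 1) by apply: mulr_ge0; lra.
have h5 : 0 <= t' * (2 * A + 2 * N - 2 * B + 1) by apply: mulr_ge0; lra.
have h6 : 0 <= (1 - t') * (2 * A + 2 * N - 2 * B + 1) by apply: mulr_ge0; lra.
do 6?[case: i lti leij => [|i] lti leij] => //;
do 6?[case: j ltj leij => [|j] ltj leij] => //; move=> -[e1 e2]; lra.
Qed.

(* c is the difference of kx + y between the first bends of two edges. The same
   difference for ky - x arises from a, b, a', b' := b', a, b, a'. *)
Lemma rotated_coordinate_gap (n a b a' b' : nat) (K := (4 * n%:R ^+ 2 + 1 : R)) :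
  (a < n)%N -> (b < n)%N -> (a' < n)%N -> (b' < n)%N -> (a, b) <> (a', b') ->
  let c := 2 * n%:R * (2 * b%:R - 2 * b'%:R) + (2 * a%:R - 2 * a'%:R) in
  - K < c < 0 \/ 0 < c < K.
Proof.
move=> an bn a'n b'n ne c.
have leR (p q : nat) : (p <= q)%N -> p%:R <= q%:R :> R by rewrite ler_nat.
have hn : 1 <= n%:R :> R by rewrite ler1n; apply: leq_ltn_trans an.
have sq : 0 <= n%:R * (n%:R - 1) :> R by apply: mulr_ge0; lra.
have := (leR _ _ an, leR _ _ bn, leR _ _ a'n, leR _ _ b'n).
rewrite -!natr1 => -[[[+ +] +] +] => hA hB hA' hB'.
have pos p : 0 <= p%:R :> R := leR _ _ (leq0n p).
have [A0 B0 A'0 B'0] := And4 (pos a) (pos b) (pos a') (pos b').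
(* As [|b - b'| <= n - 1], [|c| <= 4n(n - 1) + 2(n - 1) < K]. If [b] and [b'] differ, [4n(b - b')]
   outweighs [2(a - a')] and fixes the sign of [c]. *)
have u1 : 0 <= n%:R * (n%:R - 1 - b%:R + b'%:R) :> R by apply: mulr_ge0; lra.
have u2 : 0 <= n%:R * (n%:R - 1 + b%:R - b'%:R) :> R by apply: mulr_ge0; lra.
rewrite /c /K expr2 {c K}.
case: (nat_gap b b') => [bb|h|h].
- rewrite bb; case: (nat_gap a a') => [aa|h'|h'].
  + by case: ne; congr pair; apply/eqP; rewrite -(eqr_nat R); apply/eqP.
  + left; lra.
  + right; lra.
- have u3 : 0 <= n%:R * (b'%:R - b%:R - 1) :> R by apply: mulr_ge0; lra.
  left; lra.
- have u3 : 0 <= n%:R * (b%:R - b'%:R - 1) :> R by apply: mulr_ge0; lra.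
  right; lra.
Qed.

(* The middle segments in the orthogonal frame with origin q and axes d, e:
   along_d is the coordinate along d, read off kx + y, and along_e the one
   along e, read off ky - x. *)
Definition along_d (i : nat) (t : R) : R :=
  match i with 1 => t | 2 => 1 | 3 => 1 - t | _ => 0 end.

Definition along_e (i : nat) (t : R) : R :=
  match i with 1 => 0 | 2 => 2 * t | 3 => 2 | _ => 2 - t end.

(** The left-hand sides are the inner products of the point with d and e, whose common squared
    length is [4 * N ^+ 2 + 1]. *)
Lemma track_rotated (N A B t : R) i (z := up_point N A B i t) : (0 < i < 5)%N ->
  2 * N * z.1 + z.2 = 2 * N * (2 * B) + 2 * A + (4 * N ^+ 2 + 1) * along_d i t /\
  2 * N * z.2 - z.1 = 2 * N * (2 * A) - 2 * B + (4 * N ^+ 2 + 1) * along_e i t.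
Proof. by rewrite {}/z; do 5?[case: i => [|i]] => //= _; split; ring. Qed.

Lemma fractional_ratio (K c p q : R) : - K < c < 0 \/ 0 < c < K ->
  c = K * (p - q) -> - 1 < p - q < 0 \/ 0 < p - q < 1.
Proof.
move=> + cE; rewrite {}cE => -[] /andP[lo hi].
  have K0 : 0 < K by lra.
  by left; rewrite -(pmulr_rlt0 _ K0) hi -(ltr_pM2l K0) mulrN1 lo.
have K0 : 0 < K by lra.
by right; rewrite -(pmulr_rgt0 _ K0) lo -(ltr_pM2l K0) mulr1 hi.
Qed.

(** At a common point the coordinates along d differ by [c / K] and those along e by [f / K], both
    nonzero and below 1 in absolute value. On each segment one coordinate is a constant integer, and
    at its ends both are integers; so parallel segments, or an end of one segment on the other,
    would give an integer difference. *)
Lemma track_meet (N A B A' B' t t' : R) i j (K := 4 * N ^+ 2 + 1)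
    (c := 2 * N * (2 * B - 2 * B') + (2 * A - 2 * A'))
    (f := 2 * N * (2 * A - 2 * A') + (2 * B' - 2 * B)) :
  (0 < i < 5)%N -> (0 < j < 5)%N ->
  - K < c < 0 \/ 0 < c < K -> - K < f < 0 \/ 0 < f < K ->
  0 <= t <= 1 -> 0 <= t' <= 1 ->
  up_point N A B i t = up_point N A' B' j t' ->
  [/\ odd i = ~~ odd j, 0 < t < 1 & 0 < t' < 1].
Proof.
move=> hi hj gP gQ /andP[t0 t1] /andP[t'0 t'1] e.
have [] := track_rotated N A B t hi; have [] := track_rotated N A' B' t' hj.
rewrite e => -> -> eP eQ.
have {}gP : - 1 < along_d j t' - along_d i t < 0 \/ 0 < along_d j t' - along_d i t < 1.
  by apply: fractional_ratio gP _; rewrite /c /K; lra.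
have {}gQ : - 1 < along_e j t' - along_e i t < 0 \/ 0 < along_e j t' - along_e i t < 1.
  by apply: fractional_ratio gQ _; rewrite /f /K; lra.
move: hi hj t0 t1 t'0 t'1 gP gQ; clear.
do 5?[case: i => [|i]] => // _; do 5?[case: j => [|j]] => // _ ? ? ? ? /=.
all: by case=> /andP[? ?]; case=> /andP[? ?]; split=> //; lra.
Qed.

(** * Meetings that involve a first or a last segment *)

(** The strips [2A - 1 <= y <= 2A] are disjoint, so the height determines [A] and the parameter; at
    equal parameters the abscissas differ by [2t(B - B')]. *)
Lemma row_fan_meet (N A B A' B' t t' : R) :
  [\/ A = A', A + 1 <= A' | A' + 1 <= A] ->
  [\/ B = B', B + 1 <= B' | B' + 1 <= B] ->
  0 <= t <= 1 -> 0 <= t' <= 1 ->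
  up_point N A B 0 t = up_point N A' B' 0 t' ->
  A = A' /\ (B = B' \/ t = 0 /\ t' = 0).
Proof.
move=> gA gB /andP[t0 t1] /andP[t'0 t'1] [e1 e2].
have AA' : A = A' by case: gA => [//|h|h]; lra.
have tt' : t = t' by lra.
split=> //; case: gB => gB; first by left.
all: right; have /eqP : t * (B - B') = 0 by rewrite -AA' -tt' in e1; lra.
all: rewrite mulf_eq0 => /orP[] /eqP ?; lra.
Qed.

(** Here the abscissa determines [B] and the parameter, and the ordinates then differ by
    [2(1 - t)(A - A')]. *)
Lemma column_fan_meet (N A B A' B' t t' : R) :
  [\/ A = A', A + 1 <= A' | A' + 1 <= A] ->
  [\/ B = B', B + 1 <= B' | B' + 1 <= B] ->
  0 <= t <= 1 -> 0 <= t' <= 1 ->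
  up_point N A B 5 t = up_point N A' B' 5 t' ->
  B = B' /\ (A = A' \/ t = 1 /\ t' = 1).
Proof.
move=> gA gB /andP[t0 t1] /andP[t'0 t'1] [e1 e2].
have BB' : B = B' by case: gB => [//|h|h]; lra.
have tt' : t = t' by lra.
split=> //; case: gA => gA; first by left.
all: right; have /eqP : (1 - t) * (A - A') = 0 by rewrite -BB' -tt' in e2; lra.
all: rewrite mulf_eq0 => /orP[] /eqP ?; lra.
Qed.

(** The first segment has [x >= 2A] and [y <= 2A], the last one [x <= 2B'] and [y >= 2B' - 1]. By
    integrality [A = B'], and only the shared vertex is left. *)
Lemma row_column_fan_meet (N A B A' B' t t' : R) :
  A + 1 <= B -> A' + 1 <= B' -> B' + 1 <= N -> 0 <= A' ->
  [\/ A = B', A + 1 <= B' | B' + 1 <= A] ->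
  0 <= t <= 1 -> 0 <= t' <= 1 ->
  up_point N A B 0 t = up_point N A' B' 5 t' ->
  [/\ A = B', t = 0 & t' = 1].
Proof.
move=> AB AB' BN A'0 g /andP[t0 t1] /andP[t'0 t'1] [e1 e2].
have h1 : 0 <= t * (B - A - 1) by apply: mulr_ge0; lra.
have h2 : 0 <= (1 - t') * (2 * A' + 2 * N - 2 * B' + 1) by apply: mulr_ge0; lra.
have ee : A = B' by case: g => [//|h|h]; lra.
by rewrite -ee in e1; split=> //; lra.
Qed.

(** Segments 2, 3 and 4 lie to the right of or above every first segment. Segment 1 can be met only
    at its start [q], where the first segment of the same edge ends. *)
Lemma row_fan_avoids_track (N A B A' B' t t' : R) j :
  (0 < j < 5)%N -> 0 <= A -> 0 <= A' ->
  A + 1 <= B -> A' + 1 <= B' -> B + 1 <= N -> B' + 1 <= N ->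
  [\/ A = A', A + 1 <= A' | A' + 1 <= A] ->
  [\/ B = B', B + 1 <= B' | B' + 1 <= B] ->
  0 <= t <= 1 -> 0 <= t' <= 1 ->
  up_point N A B 0 t = up_point N A' B' j t' -> A = A' /\ B = B'.
Proof.
move=> hj A0 A'0 AB AB' BN BN' gA gB /andP[t0 t1] /andP[t'0 t'1].
have h1 : 0 <= (1 - t) * (B - A - 1) by apply: mulr_ge0; lra.
have h2 : 0 <= t' * (N - 1) by apply: mulr_ge0; lra.
have h3 : 0 <= (1 - t') * (N - 1) by apply: mulr_ge0; lra.
do 5?[case: j hj => [|j] hj] => //; move=> [e1 e2]; last 3 first.
- suff: (1 : R) <= 0 by rewrite ler10.
  clear gA gB; lra.
- suff: (1 : R) <= 0 by rewrite ler10.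
  clear gA gB; lra.
- suff: (1 : R) <= 0 by rewrite ler10.
  clear gA gB; lra.
have AA' : A = A'.
  case: gA => [//|g|g]; first by clear gB; lra.
  (* A higher row can be reached only at the far end of segment 1, which is too far to the right. *)
  have tE' : t' = 1 by clear gB; lra.
  by rewrite tE' in e1; clear gB; lra.
have tE : t = 1 by lra.
have tE' : t' = 0 by lra.
by rewrite tE tE' in e1; split=> //; lra.
Qed.

(** Segment 2 lies to the right of every last segment and segment 3 above it, while segment 1 is too
    low where it reaches the strip of [B]. Segment 4 can be met only at its end [q + e]. *)
Lemma column_fan_avoids_track (N A B A' B' t t' : R) j :
  (0 < j < 5)%N -> 0 <= A -> 0 <= A' ->
  A + 1 <= B -> A' + 1 <= B' -> B + 1 <= N -> B' + 1 <= N ->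
  [\/ A = A', A + 1 <= A' | A' + 1 <= A] ->
  [\/ B = B', B + 1 <= B' | B' + 1 <= B] ->
  0 <= t <= 1 -> 0 <= t' <= 1 ->
  up_point N A' B' j t' = up_point N A B 5 t -> A = A' /\ B = B'.
Proof.
move=> hj A0 A'0 AB AB' BN BN' gA gB /andP[t0 t1] /andP[t'0 t'1].
have h1 : 0 <= (1 - t) * (2 * A + 2 * N - 2 * B + 1) by apply: mulr_ge0; lra.
have h1' : 0 <= t * (2 * A + 2 * N - 2 * B + 1) by apply: mulr_ge0; lra.
have h2 : 0 <= t' * (N - 1) by apply: mulr_ge0; lra.
have h3 : 0 <= (1 - t') * (N - 1) by apply: mulr_ge0; lra.
do 5?[case: j hj => [|j] hj] => //; move=> [e1 e2].
- suff: (1 : R) <= 0 by rewrite ler10.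
  case: gB => gB; clear gA; lra.
- suff: (1 : R) <= 0 by rewrite ler10.
  clear gA gB; lra.
- suff: (1 : R) <= 0 by rewrite ler10.
  clear gA gB; lra.
have BB' : B = B'.
  case: gB => [//|g|g]; last by clear gA; lra.
  have tE' : t' = 0 by clear gA; lra.
  by rewrite tE' in e2; clear gA; lra.
have tE : t = 0 by lra.
have tE' : t' = 1 by lra.
by rewrite tE tE' in e2; split=> //; lra.
Qed.

(** * Common points of two distinct edges *)

Definition proper_crossing (i j : nat) (t t' : R) : Prop :=
  [/\ (0 < i < 5)%N, (0 < j < 5)%N, odd i = ~~ odd j, 0 < t < 1 & 0 < t' < 1].

Definition at_end (i : nat) (t : R) : Prop :=
  i = 0%N /\ t = 0 \/ i = 5%N /\ t = 1.

(** Segment 0, segments 1 to 4 and segment 5 form three classes; each pair of classes is covered by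
    one of the preceding lemmas. *)
Lemma up_point_meet n a b a' b' i j (t t' : R) :
  (a < b < n)%N -> (a' < b' < n)%N -> (a, b) <> (a', b') ->
  (i < 6)%N -> (j < 6)%N -> 0 <= t <= 1 -> 0 <= t' <= 1 ->
  up_point n%:R a%:R b%:R i t = up_point n%:R a'%:R b'%:R j t' ->
  proper_crossing i j t t' \/
  [/\ at_end i t, at_end j t' &
      (if i == 0 then a else b) = (if j == 0 then a' else b')].
Proof.
wlog leij : i j a b a' b' t t' / (i <= j)%N.
  move=> wl hab hab' ne lti ltj ti tj e.
  case/orP: (leq_total i j) => h; first exact: (wl i j).
  case: (wl j i a' b' a b t' t h hab' hab (not_eq_sym ne) ltj lti tj ti (esym e)).
    by move=> [? ? od ? ?]; left; split=> //; rewrite od negbK.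
  by move=> [? ? ?]; right; split.
move=> /andP[ab bn] /andP[ab' bn'] ne lti ltj ti tj e.
have an := ltn_trans ab bn; have an' := ltn_trans ab' bn'.
have leR (p q : nat) : (p <= q)%N -> p%:R <= q%:R :> R by rewrite ler_nat.
have succR (p q : nat) : (p < q)%N -> p%:R + 1 <= q%:R :> R by rewrite natr1; apply: leR.
have inj (p q : nat) : p%:R = q%:R :> R -> p = q by move/eqP; rewrite eqr_nat => /eqP.
have eq_edge : a%:R = a'%:R :> R /\ b%:R = b'%:R :> R -> False.
  by move=> [/inj ? /inj ?]; apply: ne; congr pair.
have [ab1 bn1 ab1' bn1'] := And4 (succR _ _ ab) (succR _ _ bn) (succR _ _ ab') (succR _ _ bn').
have [a0 a0'] := conj (leR _ _ (leq0n a)) (leR _ _ (leq0n a')).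
have gaa := nat_gap a a'; have gbb := nat_gap b b'.
have [i0|i0] := posnP i; last have [i5|i5] := ltnP i 5.
- rewrite {}i0 in e leij *; have [j0|j0] := posnP j; last have [j5|j5] := ltnP j 5.
  + rewrite {}j0 in e *; have [/inj aa] := row_fan_meet gaa gbb ti tj e.
    by case=> [bb|[-> ->]]; [case: eq_edge; rewrite aa|right; split=> //; left].
  + case: eq_edge; apply: row_fan_avoids_track gaa gbb ti tj e => //; exact/andP.
  + have j5' : j = 5%N by apply/eqP; rewrite eqn_leq j5 -ltnS ltj.
    rewrite {}j5' in e *.
    have [/inj -> -> ->] := row_column_fan_meet ab1 ab1' bn1' a0' (nat_gap a b') ti tj e.
    by right; split; [left|right|].
- left; have [j5|j5] := ltnP j 5.
    have hi : (0 < i < 5)%N by apply/andP.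
    have hj : (0 < j < 5)%N by rewrite j5 andbT; exact: leq_trans leij.
    have neQ : (b', a) <> (b, a') by move=> [? ?]; apply: ne; congr pair.
    have gP := @rotated_coordinate_gap n a b a' b' an bn an' bn' ne.
    have gQ := @rotated_coordinate_gap n b' a b a' bn' an bn an' neQ.
    by have [? ? ?] := track_meet hi hj gP gQ ti tj e; split.
  have j5' : j = 5%N by apply/eqP; rewrite eqn_leq j5 -ltnS ltj.
  rewrite {}j5' in e *; have hi : (0 < i < 5)%N by apply/andP.
  have [] := column_fan_avoids_track hi a0' a0 ab1' ab1 bn1' bn1 _ _ tj ti e.
  + by case: gaa => ?; [apply: Or31|apply: Or33|apply: Or32].
  + by case: gbb => ?; [apply: Or31|apply: Or33|apply: Or32].
  + by move=> /esym aa /esym bb; case: eq_edge.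
- have i5' : i = 5%N by apply/eqP; rewrite eqn_leq i5 -ltnS lti.
  have j5' : j = 5%N by apply/eqP; rewrite eqn_leq -ltnS ltj -{1}i5'.
  rewrite {}i5' {}j5' in e *; have [/inj bb] := column_fan_meet gaa gbb ti tj e.
  by case=> [aa|[-> ->]]; [case: eq_edge; rewrite bb|right; split=> //; right].
Qed.
End Geometry.

(** * Reversal and perpendicular segments *)

Section Polylines.
Variable R : realType.

Lemma seg_point_rev (s : seq gpoint) i (t : R) : (i.+1 < size s)%N ->
  seg_point (rev s) i t = seg_point s (size s - i.+2) (1 - t).
Proof.
move=> lti; rewrite /seg_point !nth_rev ?(ltnW lti) //.
have -> : (size s - i.+1 = (size s - i.+2).+1)%N by lia.
by congr pair; ring.
Qed.

Lemma direction_rev (s : seq gpoint) i (d := direction s (size s - i.+2)) :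
  (i.+1 < size s)%N -> direction (rev s) i = (- d.1, - d.2).
Proof.
move=> lti; rewrite /d /direction !nth_rev ?(ltnW lti) //.
have -> : (size s - i.+1 = (size s - i.+2).+1)%N by lia.
by rewrite /= !opprB.
Qed.

Lemma simple_polyline_rev (s : seq gpoint) :
  simple_polyline R s -> simple_polyline R (rev s).
Proof.
move=> simple i j t u; rewrite size_rev => lti ltj ti uj.
rewrite !seg_point_rev // => /simple.
have onem (x : R) : 0 <= x <= 1 -> 0 <= 1 - x <= 1 by lra.
move=> /(_ _ _ (onem _ ti) (onem _ uj)).
rewrite !natrB // -(natr1 i.+1) -(natr1 i) -(natr1 j.+1) -(natr1 j).
have lt1 k : (k.+1 < size s)%N -> ((size s - k.+2).+1 < size s)%N by lia.
by move=> /(_ (lt1 _ lti) (lt1 _ ltj)); lra.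
Qed.

(** The points agree rather than the parameters, since a degenerate segment attains its point at
    many parameters. *)
Lemma perpendicular_segments_meet_once (s s' : seq gpoint) i j (t t' u u' : R) :
  perpendicular (direction s i) (direction s' j) ->
  seg_point s i t = seg_point s' j t' -> seg_point s i u = seg_point s' j u' ->
  seg_point s i t = seg_point s i u.
Proof.
move=> /(congr1 (fun x => x%:~R : R)) /=.
rewrite !(rmorphB, rmorphD, rmorphM, rmorph0) /= /seg_point /embed /=.
set p := (nth _ s i).1%:~R; set q := (nth _ s i.+1).1%:~R.
set p2 := (nth _ s i).2%:~R; set q2 := (nth _ s i.+1).2%:~R.
set r := (nth _ s' j).1%:~R; set o := (nth _ s' j.+1).1%:~R.
set r2 := (nth _ s' j).2%:~R; set o2 := (nth _ s' j.+1).2%:~R.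
move=> perp [e1 e2] [f1 f2].
have sq0 (x y : R) : x ^+ 2 + y ^+ 2 = 0 -> x = 0 /\ y = 0.
  move/eqP; rewrite paddr_eq0 ?sqr_ge0 // !sqrf_eq0.
  by case/andP => /eqP -> /eqP ->.
have g1 : (t - u) * (q - p) = (t' - u') * (o - r) by lra.
have g2 : (t - u) * (q2 - p2) = (t' - u') * (o2 - r2) by lra.
(* The two differences along the segments are equal and orthogonal. *)
have [] := sq0 ((t - u) * (q - p)) ((t - u) * (q2 - p2)).
  rewrite !expr2 {2}g1 {2}g2.
  transitivity ((t - u) * (t' - u') * ((q - p) * (o - r) + (q2 - p2) * (o2 - r2))).
    ring.
  by rewrite perp mulr0.
by move=> h1 h2; congr pair; lra.
Qed.

(** There are finitely many pairs of segments, and each perpendicular pair contributes at most one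
    point. *)
Lemma perpendicular_intersections_finite (s s' : seq gpoint) :
  finite_set [set z : R * R | exists i j t t',
    [/\ (i.+1 < size s)%N, (j.+1 < size s')%N,
        perpendicular (direction s i) (direction s' j),
        z = seg_point s i t & z = seg_point s' j t']]%classic.
Proof.
pose meet (ij : 'I_(size s) * 'I_(size s')) : set (R * R) :=
  [set z | exists t t', [/\ perpendicular (direction s ij.1) (direction s' ij.2),
        z = seg_point s ij.1 t & z = seg_point s' ij.2 t']]%classic.
apply: (@sub_finite_set _ _ (\bigcup_(ij in [set: 'I_(size s) * 'I_(size s')]) meet ij)%classic).
  move=> z [i [j [t [t' [lti ltj perp zi zj]]]]].
  exists (Ordinal (ltnW lti), Ordinal (ltnW ltj)) => //.
  by exists t, t'.
apply: bigcup_finite => [|ij _]; first exact: finite_finset.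
have [[z [t [t' [perp zi zj]]]]|none] := pselect (exists z, meet ij z).
  apply: (@sub_finite_set _ _ [set z]%classic); last exact: finite_set1.
  move=> w [u [u' [_ wi wj]]] /=.
  rewrite [LHS]wi [RHS]zi; apply: (perpendicular_segments_meet_once perp).
    exact: etrans (esym wi) wj.
  exact: etrans (esym zi) zj.
apply: (@sub_finite_set _ _ set0); last exact: finite_set0.
by move=> z mz; case: none; exists z.
Qed.
End Polylines.

(** * The drawing *)

(** Every pair of vertices gets a route, so one drawing of the complete graph serves all graphs on
    [n] vertices. *)
Definition rect_drawing (n : nat) : drawing n :=
  Drawing (fun u : 'I_n => vertex_pos u)
    (fun u v : 'I_n => if (u <= v)%N then up_bends n u v else rev (up_bends n v u)).

Section RectDrawing.
Variables (R : realType) (n : nat).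
Local Notation D := (rect_drawing n).
Implicit Types u v w x y : 'I_n.

Lemma rect_bends_rev u v : u != v -> bends D v u = rev (bends D u v).
Proof. by rewrite -val_eqE /=; case: (ltngtP u v) => //= _; rewrite revK. Qed.

Lemma size_rect_bends u v : size (bends D u v) = 5.
Proof. by rewrite /=; case: ifP; rewrite ?size_rev. Qed.

Lemma size_rect_route u v : size (route D u v) = 7.
Proof. by rewrite /route /= size_rcons size_rect_bends. Qed.

Lemma rect_route_lt u v : (u < v)%N -> route D u v = up_route n u v.
Proof. by move=> /ltnW uv; rewrite /route /= uv. Qed.

Lemma rect_route_rev u v : u != v -> route D v u = rev (route D u v).
Proof. by move=> uv; rewrite /route rect_bends_rev // rev_cons rev_rcons. Qed.

(** Segments 1 to 4 have the directions d, 2e, -d and -e, and d and e are the same for all edges. *)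
Lemma direction_up_route_perpendicular a b a' b' i j :
  (0 < i < 5)%N -> (0 < j < 5)%N -> odd i = ~~ odd j ->
  perpendicular (direction (up_route n a b) i) (direction (up_route n a' b') j).
Proof.
rewrite /perpendicular /direction.
do 5?[case: i => [|i]] => // _; do 5?[case: j => [|j]] => // _ _ /=; ring.
Qed.

(** The negated bounds exclude the second alternative at interior points of segments, as the RAC
    condition requires. *)
Definition crossing_or_vertex u v x y i j (t t' : R) : Prop :=
  [/\ perpendicular (direction (route D u v) i) (direction (route D x y) j),
      0 < t < 1 & 0 < t' < 1] \/
  exists w, [/\ w \in [:: u; v], w \in [:: x; y],
     seg_point (route D u v) i t = embed R (vpos D w),
     ~~ (0 < t < 1) & ~~ (0 < t' < 1)].

Lemma crossing_or_vertex_sym u v x y i j (t t' : R) :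
  seg_point (route D u v) i t = seg_point (route D x y) j t' ->
  crossing_or_vertex u v x y i j t t' -> crossing_or_vertex x y u v j i t' t.
Proof.
move=> e [[perp ? ?]|[w [? ? ? ? ?]]]; last by right; exists w; rewrite -e.
by left; split=> //; move: perp; rewrite /perpendicular mulrC [X in _ + X]mulrC.
Qed.

Lemma flip_unit (t : R) : (0 < 1 - t < 1) = (0 < t < 1).
Proof. by apply/idP/idP => ?; lra. Qed.

(** Reversing a route of six segments sends segment [i] to [5 - i] and the parameter [t] to
    [1 - t]. *)
Lemma crossing_or_vertex_flip u v x y i j (t t' : R) : u != v -> (i < 6)%N ->
  crossing_or_vertex v u x y (5 - i) j (1 - t) t' ->
  crossing_or_vertex u v x y i j t t'.
Proof.
move=> uv lti; rewrite /crossing_or_vertex flip_unit.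
have lti' : (i.+1 < size (route D v u))%N by rewrite size_rect_route.
have vu : v != u by rewrite eq_sym.
rewrite (rect_route_rev vu) seg_point_rev // direction_rev // size_rect_route.
move=> [[perp ? ?]|[w [wvu ? ? ? ?]]].
  by left; split=> //; move: perp; rewrite /perpendicular /= !mulNr -opprD => ->; rewrite oppr0.
by right; exists w; split=> //; move: wvu; rewrite !inE orbC.
Qed.

Lemma seg_point_flip u v i (t : R) : u != v -> (i < 6)%N ->
  seg_point (route D u v) i t = seg_point (route D v u) (5 - i) (1 - t).
Proof.
move=> uv lti; have vu : v != u by rewrite eq_sym.
by rewrite (rect_route_rev vu) seg_point_rev size_rect_route.
Qed.

(** Reversing either edge preserves the alternatives, so both may be assumed to go from the smaller
    to the larger vertex, where [up_point_meet] applies. *)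
Lemma rect_route_meet u v x y i j (t t' : R) :
  u != v -> x != y -> [set u; v]%SET <> [set x; y]%SET ->
  (i < 6)%N -> (j < 6)%N -> 0 <= t <= 1 -> 0 <= t' <= 1 ->
  seg_point (route D u v) i t = seg_point (route D x y) j t' ->
  crossing_or_vertex u v x y i j t t'.
Proof.
wlog uv : u v i t / (u < v)%N.
  move=> wl uv xy ne lti ltj ti tj e; have := uv; rewrite neq_ltn => /orP[h|h].
    exact: wl.
  apply: crossing_or_vertex_flip => //; apply: wl => //; rewrite ?(eq_sym v) //.
  - by rewrite finset.setUC.
  - by lia.
  - by lra.
  - by rewrite -seg_point_flip.
wlog xy : x y j t' / (x < y)%N.
  move=> wl uv' xy ne lti ltj ti tj e; have := xy; rewrite neq_ltn => /orP[h|h].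
    exact: wl.
  apply: (crossing_or_vertex_sym (esym e)); apply: crossing_or_vertex_flip => //.
  rewrite (seg_point_flip _ xy) // in e.
  apply: (crossing_or_vertex_sym e); apply: wl => //; rewrite ?(eq_sym y) //.
  - by rewrite [[set y; x]%SET]finset.setUC.
  - by lia.
  - by lra.
move=> _ _ ne lti ltj ti tj.
have ne' : (nat_of_ord u, nat_of_ord v) <> (nat_of_ord x, nat_of_ord y).
  by move=> [/val_inj ux /val_inj vy]; apply: ne; rewrite ux vy.
rewrite /crossing_or_vertex !rect_route_lt // !seg_point_up_route // => e.
have hn : forall p q : 'I_n, (p < q)%N -> (p < q < n)%N by move=> p q ->; rewrite /=.
have [[? ? ? ? ?]|[ei ej ww]] := up_point_meet (hn _ _ uv) (hn _ _ xy) ne' lti ltj ti tj e.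
  by left; split=> //; apply: direction_up_route_perpendicular.
right; exists (if i == 0%N then u else v); split.
- by case: ifP; rewrite !inE eqxx ?orbT.
- have -> : (if i == 0%N then u else v) = (if j == 0%N then x else y).
    by apply: val_inj; rewrite !(fun_if val).
  by case: ifP; rewrite !inE eqxx ?orbT.
- rewrite /= /embed; case: ei => -[-> ->] /=;
  rewrite ?(rmorphB, rmorphD, rmorphM, rmorph1) /= -!pmulrn; congr pair; ring.
- by case: ei => -[_ ->]; rewrite ltxx ?andbF.
- by case: ej => -[_ ->]; rewrite ltxx ?andbF.
Qed.

Lemma rect_route_simple u v : u != v -> simple_polyline R (route D u v).
Proof.
wlog uv : u v / (u < v)%N.
  move=> wl uv; have := uv; rewrite neq_ltn => /orP[h|h]; first exact: wl.
  rewrite rect_route_rev 1?eq_sym //; apply: simple_polyline_rev.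
  by apply: wl; rewrite 1?eq_sym.
move=> _ i j t t'; rewrite size_rect_route => lti ltj ti tj.
rewrite rect_route_lt // !seg_point_up_route //.
apply: up_point_inj => //; first by rewrite natr1 ler_nat.
by rewrite natr1 ler_nat.
Qed.

Lemma vertex_pos_inj : injective vertex_pos.
Proof. by move=> a b [e _]; lia. Qed.

Lemma embed_inj : injective (embed R).
Proof. by move=> [a b] [c d] [/intr_inj -> /intr_inj ->]. Qed.

Lemma seg_point_start s : seg_point s 0 0 = embed R (nth (0, 0) s 0).
Proof. by rewrite /seg_point subr0 !mul1r !mul0r !addr0 -surjective_pairing. Qed.

(** Reduces to [rect_route_meet], which holds for all pairs of vertices, adjacent or not. *)
Lemma rect_route_avoids_vertices u v w : u != v ->
  curve (route D u v) (embed R (vpos D w)) -> w \in [:: u; v].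
Proof.
move=> uv [i [t [lti ti e]]]; apply/negPn/negP => nw.
(* A vertex w off the edge would be the start of the distinct edge wu. *)
have wu : w != u by move: nw; rewrite !inE negb_or => /andP[].
have ne : [set u; v]%SET <> [set w; u]%SET.
  by move=> /setP/(_ w); rewrite !inE eqxx; move: nw; rewrite !inE => /negbTE ->.
rewrite size_rect_route in lti.
have h0 : 0 <= (0 : R) <= 1 by rewrite lexx ler01.
have e' : seg_point (route D u v) i t = seg_point (route D w u) 0 0.
  by rewrite -e seg_point_start.
have [[_ _]|[x [xuv _ + _ _]]] := rect_route_meet uv wu ne lti (isT : (0 < 6)%N) ti h0 e'.
  by rewrite ltxx.
rewrite -e => /embed_inj/vertex_pos_inj/val_inj xw.
by rewrite xw xuv in nw.
Qed.

Lemma rect_drawing_rac (G : sgraph n) : rac_drawing R G D.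
Proof.
have neqG u v : G u v -> u != v.
  by move=> uv; apply/eqP => e; rewrite e (adj_irrefl G) in uv.
split; first split.
- by move=> u v /vertex_pos_inj/val_inj.
- by move=> u v /neqG; apply: rect_bends_rev.
- by move=> u v /neqG; apply: rect_route_simple.
- by move=> u v w /neqG; apply: rect_route_avoids_vertices.
- move=> u v x y [/neqG uv /neqG xy ne] common; split.
    (* Common points are intersections of perpendicular segments or vertices, finitely many of each
       kind. *)
    apply: (@sub_finite_set _ _
      ([set z : R * R | exists i j t t',
        [/\ (i.+1 < size (route D u v))%N, (j.+1 < size (route D x y))%N,
        perpendicular (direction (route D u v) i) (direction (route D x y) j),
        z = seg_point (route D u v) i t & z = seg_point (route D x y) j t']] `|`
       [set embed R (vpos D w) | w in [set: 'I_n]])%classic).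
      move=> z [[i [t [lti ti zi]]] [j [t' [ltj tj zj]]]].
      have [] := rect_route_meet uv xy ne _ _ ti tj (etrans (esym zi) zj).
      + by rewrite size_rect_route in lti.
      + by rewrite size_rect_route in ltj.
      + by move=> [perp _ _]; left; exists i, j, t, t'.
      + by move=> [w [_ _ e _ _]]; right; exists w => //; rewrite zi e.
    rewrite finite_setU; split; first exact: perpendicular_intersections_finite.
    exact/finite_image/finite_finset.
  move=> z [[i [t [lti ti zi]]] [j [t' [ltj tj zj]]]].
  have [] := rect_route_meet uv xy ne _ _ ti tj (etrans (esym zi) zj).
  + by rewrite size_rect_route in lti.
  + by rewrite size_rect_route in ltj.
  + by move=> [_ ? ?]; right; exists i, j; split; [exists t|exists t'].
  + by move=> [w [? ? e _ _]]; left; exists w; rewrite zi e.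
move=> u v x y [/neqG uv /neqG xy ne] i j z [[t [lti ti zi]] [t' [ltj tj zj]]].
have le01 (r : R) : 0 < r < 1 -> 0 <= r <= 1 by lra.
have [] := rect_route_meet uv xy ne _ _ (le01 _ ti) (le01 _ tj) (etrans (esym zi) zj).
- by rewrite size_rect_route in lti.
- by rewrite size_rect_route in ltj.
- by case.
- by move=> [w [_ _ _]]; rewrite ti.
Qed.
End RectDrawing.

(** * Area *)

Lemma extent_bounds (lo hi : int) (s : seq int) : lo <= hi ->
  {in s, forall x, lo <= x <= hi} -> 0 <= extent s <= hi - lo.
Proof.
case: s => [|a s] lohi bnd; first by rewrite /extent !big_nil subrr lexx subr_ge0.
(* Maximum and minimum both return one of their arguments, so one induction serves both. *)
have in_bnd (op : int -> int -> int) :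
    (forall x y, op x y = x \/ op x y = y) ->
    lo <= \big[op/a]_(x <- a :: s) x <= hi.
  move=> opE; rewrite big_seq.
  apply: (big_ind (fun z => lo <= z <= hi)) => [|x y bx by_|x /bnd //].
    by apply: bnd; apply: mem_head.
  by case: (opE x y) => ->.
have /andP[_ max_hi] := in_bnd Order.max (fun x y => ltac:(by case: (leP x y); [right|left])).
have /andP[lo_min _] := in_bnd Order.min (fun x y => ltac:(by case: (leP x y); [left|right])).
rewrite /extent /= lerB // andbT subr_ge0 !big_cons.
by apply: (@le_trans _ _ a); rewrite ?ge_min ?le_max lexx.
Qed.

(** The largest coordinate is the ordinate [2a + 4n + 1] of [q + d + 2e], below [6n] because
    [a < n]. *)
Lemma rect_corner_bounds n (G : sgraph n) (p : gpoint) :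
  p \in corners G (rect_drawing n) ->
  (- 2 <= p.1 <= 6 * n%:Z) /\ (- 2 <= p.2 <= 6 * n%:Z).
Proof.
rewrite /corners mem_cat => /orP[/mapP[u _ ->]|/flatten_mapP[[u v]]].
  by have := ltn_ord u; rewrite /=; lia.
rewrite mem_filter /= => /andP[uv _].
have ne : (u : nat) != v.
  by apply/eqP => /val_inj e; rewrite e (adj_irrefl G) in uv.
have ltu := ltn_ord u; have ltv := ltn_ord v.
by case: ifP => uv'; rewrite ?mem_rev !inE;
  (do 4?[move=> /orP[]]); move=> /eqP -> /=; lia.
Qed.

Lemma rect_area n (G : sgraph n) : area G (rect_drawing n) <= 64 * n%:Z ^+ 2.
Proof.
(* The side bound [6n + 2 <= 8n] needs [n >= 1], so the empty drawing is treated apart. *)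
have [n0|n_gt0] := posnP n.
  have -> : area G (rect_drawing n) = 0; last by rewrite n0.
  have c0 : corners G (rect_drawing n) = [::].
    case e : (corners _ _) => [//|p s].
    have := mem_head p s; rewrite -e /corners mem_cat.
    case/orP=> [/mapP[u]|/flatten_mapP[[u v]]]; by have := ltn_ord u; rewrite [X in (_ < X)%N]n0.
  by rewrite /area c0 /extent /= !big_nil subrr mul0r.
have extent_le (f : gpoint -> int) :
    (forall p, p \in corners G (rect_drawing n) -> - 2 <= f p <= 6 * n%:Z) ->
    0 <= extent [seq f p | p <- corners G (rect_drawing n)] <= 8 * n%:Z.
  move=> fb.
  have bnd : {in [seq f p | p <- corners G (rect_drawing n)], forall x, - 2 <= x <= 6 * n%:Z}.
    by move=> x /mapP[p /fb pb ->].
  have /andP[-> le_e] := extent_bounds (ltac:(lia) : - 2 <= 6 * n%:Z) bnd.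
  by apply: le_trans le_e _; lia.
have /andP[x0 x1] := extent_le fst (fun p hp => (rect_corner_bounds hp).1).
have /andP[y0 y1] := extent_le snd (fun p hp => (rect_corner_bounds hp).2).
apply: (@le_trans _ _ ((8 * n%:Z) * (8 * n%:Z))); first exact: ler_pM.
by rewrite expr2; lia.
Qed.

Lemma rect_area_powR (R : realType) n (G : sgraph n) :
  (area G (rect_drawing n))%:~R <= 64 * (n%:R `^ (11%:R / 4%:R)) :> R.
Proof.
apply: (@le_trans _ _ (64 * n%:R ^+ 2)).
  have := rect_area G; rewrite -(ler_int R) => /le_trans; apply.
  by rewrite rmorphM rmorphXn /= -!pmulrn.
rewrite ler_pM2l // -powR_mulrn //.
(* Powers of [n] increase with the exponent only from [n = 1] on; for [n = 0] both powers vanish. *)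
have [->|n_gt0] := posnP n; first by rewrite !powR0 //; lra.
by apply: ler_powR; [rewrite ler1n|lra].
Qed.

Lemma rect_curve_complexity n (G : sgraph n) :
  (curve_complexity G (rect_drawing n) <= 6)%N.
Proof. by apply/bigmax_leqP => e _; rewrite size_rect_bends. Qed.

(** * The program *)

(* MathComp-Analysis shadows the evaluation of expressions. *)
Local Notation eval := Defs.eval.

(** * Execution within a time bound *)

Definition exec_within (c : cmd) (s : state) (T : nat) (s' : state) : Prop :=
  exists2 t, exec c s t s' & (t <= T)%N.

Lemma exec_within_seq c1 c2 s1 s2 s3 T1 T2 :
  exec_within c1 s1 T1 s2 -> exec_within c2 s2 T2 s3 ->
  exec_within (Seq c1 c2) s1 (T1 + T2) s3.
Proof.
move=> [t1 e1 l1] [t2 e2 l2]; exists (t1 + t2)%N; first exact: ExecSeq e1 e2.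
exact: leq_add.
Qed.

Lemma exec_within_assign s r e :
  exec_within (Assign r e) s (cost e).+1
    (State (upd (regs s) r (eval s e)) (memory s) (out s)).
Proof. by exists (cost e).+1; first exact: ExecAssign. Qed.

Lemma exec_within_if s s1 e c1 c2 T :
  exec_within (if eval s e == 0 then c2 else c1) s T s1 ->
  exec_within (If e c1 c2) s (cost e + T).+1 s1.
Proof.
move=> [t ex le]; exists (cost e + t).+1; last by rewrite ltnS leq_add2l.
by case: eqVneq ex => e0 ex; [apply: ExecIfFalse|apply: ExecIfTrue].
Qed.

(** The invariant is indexed by the number of completed iterations; [m] successful tests with their
    bodies precede one failing test. *)
Lemma exec_within_while (I : nat -> state -> Prop) e c T m s :
  (forall i s, (i < m)%N -> I i s ->
    eval s e != 0 /\ exists2 s', exec_within c s T s' & I i.+1 s') ->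
  (forall s, I m s -> eval s e = 0) -> I 0 s ->
  exists2 s', exec_within (While e c) s ((cost e + T).+1 * m + (cost e).+1) s' & I m s'.
Proof.
move=> step stop.
have gen k : forall i s, (i + k = m)%N -> I i s ->
    exists2 s', exec_within (While e c) s ((cost e + T).+1 * k + (cost e).+1) s' & I m s'.
  elim: k => [|k IH] i s1 ik Ii.
    move: ik Ii; rewrite addn0 => -> Im; exists s1 => //.
    by exists (cost e).+1; [apply/ExecWhileStop/stop|rewrite muln0].
  have im : (i < m)%N by rewrite -ik addnS ltnS leq_addr.
  have [ne [s2 [t1 ex1 le1] I2]] := step _ _ im Ii.
  have [|s3 [t2 ex2 le2] I3] := IH i.+1 s2 _ I2; first by rewrite addSnnS.
  exists s3 => //; exists (cost e + t1 + t2).+1; first exact: ExecWhileStep ex1 ex2.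
  by rewrite mulnS; lia.
by move=> I0; apply: gen I0; rewrite add0n.
Qed.

Definition prints (es : seq expr) : cmd := foldr (fun e => Seq (Print e)) Skip es.

Lemma eval_out s o e : eval (State (regs s) (memory s) o) e = eval s e.
Proof. by elim: e => //= [e ->|b e1 -> e2 ->]. Qed.

(** Evaluation does not read the output tape, so all expressions take their values in the starting
    state. The final 1 pays for [Skip]. *)
Lemma exec_prints s es :
  exec_within (prints es) s (\sum_(e <- es) (cost e).+1 + 1)
    (State (regs s) (memory s) (out s ++ map (eval s) es)).
Proof.
elim: es s => [|e es IH] s /=.
  by rewrite cats0; case: s => *; exists 1%N; rewrite ?big_nil //; apply: ExecSkip.
rewrite big_cons -addnA; apply: exec_within_seq.
  by exists (cost e).+1; first exact: ExecPrint.
have := IH (State (regs s) (memory s) (rcons (out s) (eval s e))).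
rewrite /= cat_rcons; congr exec_within; congr State.
by congr (_ ++ _ :: _); apply: eq_map => e'; apply: eval_out.
Qed.

(** * The drawing program *)

Definition twice (e : expr) : expr := Op Mul (Const 2) e.

(** Registers 0 and 1 hold the numbers of vertices and edges, 2 the loop index, 3 and 4 the smaller
    and the larger endvertex. *)
Definition bend_exprs : seq (expr * expr) :=
  let n := Reg 0 in let a := Reg 3 in let b := Reg 4 in
  let n4 := Op Mul (Const 4) n in
  [:: (twice b, twice a);
      (Op Add (twice b) (twice n), Op Add (twice a) (Const 1));
      (Op Defs.Sub (Op Add (twice b) (twice n)) (Const 2),
       Op Add (Op Add (twice a) n4) (Const 1));
      (Op Defs.Sub (twice b) (Const 2), Op Add (twice a) n4);
      (Op Defs.Sub (twice b) (Const 1), Op Add (twice a) (twice n))].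

(** The leading 5 is the number of bends that the output format puts before their coordinates. *)
Definition flat_exprs (ps : seq (expr * expr)) : seq expr :=
  Const 5 :: flatten [seq [:: p.1; p.2] | p <- ps].

Definition next_index : cmd := Assign 2 (Op Add (Reg 2) (Const 1)).

Definition vertex_body : cmd :=
  Seq (prints [:: twice (Reg 2); Op Defs.Sub (twice (Reg 2)) (Const 1)]) next_index.

(** Edge [i] occupies the addresses [2i + 2] and [2i + 3], after the two header cells; [k] is 2 or
    3. *)
Definition endvertex (k : int) : expr := Fetch (Op Add (twice (Reg 2)) (Const k)).

Definition edge_body : cmd :=
  Seq (If (Op Leq (endvertex 2) (endvertex 3))
        (Seq (Assign 3 (endvertex 2)) (Seq (Assign 4 (endvertex 3))
          (prints (flat_exprs bend_exprs))))
        (Seq (Assign 3 (endvertex 3)) (Seq (Assign 4 (endvertex 2))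
          (prints (flat_exprs (rev bend_exprs))))))
      next_index.

(** Register 2 is initially 0, so it is reset only before the second loop. *)
Definition draw_program : cmd :=
  Seq (Assign 0 (Fetch (Const 0))) (Seq (Assign 1 (Fetch (Const 1)))
    (Seq (While (Op Leq (Op Add (Reg 2) (Const 1)) (Reg 0)) vertex_body)
      (Seq (Assign 2 (Const 0))
        (While (Op Leq (Op Add (Reg 2) (Const 1)) (Reg 1)) edge_body)))).

Lemma eval_bend_exprs s n a b :
  regs s 0%N = n%:Z -> regs s 3%N = a%:Z -> regs s 4%N = b%:Z ->
  [seq (eval s p.1, eval s p.2) | p <- bend_exprs] = up_bends n a b.
Proof. by move=> /= -> -> ->. Qed.

Lemma eval_flat_exprs s ps :
  map (eval s) (flat_exprs ps) =
  5 :: flatten [seq encode_point (eval s p.1, eval s p.2) | p <- ps].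
Proof. by rewrite /= map_flatten -map_comp. Qed.

Lemma nth_flatten_pairs (T : Type) (f g : T -> int) (s : seq T) x0 i : (i < size s)%N ->
  nth 0 (flatten [seq [:: f x; g x] | x <- s]) i.*2 = f (nth x0 s i) /\
  nth 0 (flatten [seq [:: f x; g x] | x <- s]) i.*2.+1 = g (nth x0 s i).
Proof. by elim: s i => [|x s IH] [|i] //= /IH. Qed.

(** * Correctness and running time of the program *)

Section Execution.
Variables (n : nat) (es : seq ('I_n * 'I_n)).
Local Notation D := (rect_drawing n).
Let mem0 := memory (init_state (encode_graph es)).

Definition loop_invariant (o : seq int) (i : nat) (s : state) : Prop :=
  [/\ memory s = mem0, regs s 0%N = n%:Z, regs s 1%N = (size es)%:Z,
      regs s 2%N = i%:Z & out s = o].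

Definition vertex_output (i : nat) : seq int :=
  flatten [seq encode_point (vertex_pos u) | u <- iota 0 i].

Definition edge_output (e : 'I_n * 'I_n) : seq int :=
  (size (bends D e.1 e.2))%:Z :: flatten (map encode_point (bends D e.1 e.2)).

Definition prefix_output (i : nat) : seq int :=
  vertex_output n ++ flatten [seq edge_output e | e <- take i es].

Lemma prefix_output_all : prefix_output (size es) = encode_drawing es D.
Proof.
rewrite /prefix_output take_size /encode_drawing; congr (_ ++ _).
by rewrite /vertex_output -val_enum_ord -map_comp.
Qed.

Lemma exec_vertex_body i s : loop_invariant (vertex_output i) i s ->
  exists2 s', exec_within vertex_body s 100 s' &
    loop_invariant (vertex_output i.+1) i.+1 s'.
Proof.
move=> [ms r0 r1 r2 os]; eexists.
  have [t et lt] := exec_within_seq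
    (exec_prints s [:: twice (Reg 2); Op Defs.Sub (twice (Reg 2)) (Const 1)])
    (exec_within_assign _ 2 (Op Add (Reg 2) (Const 1))).
  exists t; first exact: et.
  by apply: leq_trans lt _; rewrite !big_cons big_nil.
split=> //=; first by rewrite /upd /= r2; lia.
rewrite os /vertex_output -[i.+1]addn1 iotaD map_cat flatten_cat /= r2.
by rewrite add0n.
Qed.

Lemma edge_memory i e0 : (i < size es)%N ->
  mem0 (2 * i%:Z + 2) = (nth e0 es i).1%:Z /\
  mem0 (2 * i%:Z + 3) = (nth e0 es i).2%:Z.
Proof.
move=> lti.
have -> : 2 * i%:Z + 2 = i.*2.+2%:Z by lia.
have -> : 2 * i%:Z + 3 = i.*2.+3%:Z by lia.
rewrite /mem0 /=.
exact: nth_flatten_pairs.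
Qed.

Lemma exec_edge_body i s : (i < size es)%N -> loop_invariant (prefix_output i) i s ->
  exists2 s', exec_within edge_body s 300 s' &
    loop_invariant (prefix_output i.+1) i.+1 s'.
Proof.
move=> lti [ms r0 r1 r2 os].
have e0 : 'I_n * 'I_n by case: (es) lti => [|e l].
have [m2 m3] := edge_memory e0 lti.
have outE : prefix_output i.+1 = prefix_output i ++ edge_output (nth e0 es i).
  by rewrite /prefix_output (take_nth e0) // map_rcons flatten_rcons catA.
have mE k : eval s (endvertex k) = mem0 (2 * i%:Z + k) by rewrite /= r2 ms.
(* Covers both orientations: [ka] and [kb] will select the smaller and the larger endvertex, and
   [ps] the bends in the listed order. *)
have branchP ps ka kb (a b : nat) :
    (\sum_(e <- flat_exprs ps) (cost e).+1 <= 200)%N ->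
    mem0 (2 * i%:Z + ka) = a%:Z -> mem0 (2 * i%:Z + kb) = b%:Z ->
    exists2 r, exec_within (Seq (Assign 3 (endvertex ka))
        (Seq (Assign 4 (endvertex kb)) (prints (flat_exprs ps)))) s 230 r &
      [/\ memory r = mem0, forall k, (k < 3)%N -> regs r k = regs s k &
        (* [r'] is the state between the two assignments and the printing. *)
        exists2 r', [/\ regs r' 0%N = n%:Z, regs r' 3%N = a%:Z & regs r' 4%N = b%:Z] &
          out r = prefix_output i ++ map (eval r') (flat_exprs ps)].
  move=> cost_ps ma mb; eexists.
    have [t et lt] := exec_within_seq (exec_within_assign s 3 (endvertex ka))
      (exec_within_seq (exec_within_assign _ 4 (endvertex kb))
        (exec_prints _ (flat_exprs ps))).
    by exists t; [exact: et|apply: leq_trans lt _; rewrite /=; lia].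
  split=> /=; first exact: ms.
    by case=> [|[|[|]]].
  by eexists; last (rewrite os; reflexivity); rewrite /= /upd /= r0 r2 ms ma mb.
pose a := (nth e0 es i).1; pose b := (nth e0 es i).2.
(* Adds the test before the chosen branch and the increment of the loop index after it. *)
have finish c r : exec_within c s 230 r ->
    c = (if eval s (Op Leq (endvertex 2) (endvertex 3)) == 0 then
      (Seq (Assign 3 (endvertex 3)) (Seq (Assign 4 (endvertex 2))
          (prints (flat_exprs (rev bend_exprs)))))
      else Seq (Assign 3 (endvertex 2)) (Seq (Assign 4 (endvertex 3))
          (prints (flat_exprs bend_exprs)))) ->
    memory r = mem0 -> (forall k, (k < 3)%N -> regs r k = regs s k) ->
    out r = prefix_output i.+1 ->
    exists2 s', exec_within edge_body s 300 s' &
      loop_invariant (prefix_output i.+1) i.+1 s'.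
  move=> ex cE mr rr outr; rewrite cE in ex; eexists.
    have [t et lt] := exec_within_seq (exec_within_if ex) (exec_within_assign r 2
      (Op Add (Reg 2) (Const 1))).
    by exists t; [exact: et|apply: leq_trans lt _].
  by split=> //=; rewrite /upd /= rr // ?r0 ?r1 // r2; lia.
have leqE : (eval s (Op Leq (endvertex 2) (endvertex 3)) == 0) = ~~ (a <= b)%N.
  by rewrite [eval _ _]/(eval_op Leq (eval s (endvertex 2)) (eval s (endvertex 3)))
     !mE m2 m3 /= lez_nat; case: leqP.
have cost_bends : (\sum_(e <- flat_exprs bend_exprs) (cost e).+1 <= 200)%N.
  by rewrite !big_cons big_nil.
have cost_rev : (\sum_(e <- flat_exprs (rev bend_exprs)) (cost e).+1 <= 200)%N.
  by rewrite !big_cons big_nil.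
have outP ps r r' : out r = prefix_output i ++ map (eval r') (flat_exprs ps) ->
    [seq (eval r' p.1, eval r' p.2) | p <- ps] = bends D a b ->
    out r = prefix_output i.+1.
  move=> -> psE; rewrite eval_flat_exprs outE; congr (_ ++ _).
  by rewrite /edge_output size_rect_bends -psE -map_comp.
have [ab|ba] := leqP a b.
  have [r ex [mr rr [r' [r'0 r'3 r'4] outr]]] := branchP _ _ _ _ _ cost_bends m2 m3.
  apply: (finish _ r ex) => //; first by rewrite leqE ab.
  by apply: outP outr _; rewrite (eval_bend_exprs r'0 r'3 r'4) /= ab.
have [r ex [mr rr [r' [r'0 r'3 r'4] outr]]] := branchP _ _ _ _ _ cost_rev m3 m2.
apply: (finish _ r ex) => //; first by rewrite leqE -ltnNge ba.
by apply: outP outr _; rewrite map_rev (eval_bend_exprs r'0 r'3 r'4) /= leqNgt ba.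
Qed.

Lemma draw_program_runs : exists2 t,
  runs draw_program (encode_graph es) t (encode_drawing es D) &
  (t <= 1000 * (n + size es).+1)%N.
Proof.
have leqE s k : (eval s (Op Leq (Op Add (Reg 2) (Const 1)) (Reg k)) != 0) =
    (regs s 2%N + 1 <= regs s k).
  by rewrite /=; case: ifP.
(* The test costs 5, so an iteration costs at most [5 + 100 + 1], and [5 + 300 + 1] in the edge
   loop. *)
have vertex_loop s : loop_invariant (vertex_output 0) 0 s -> exists2 s',
    exec_within (While (Op Leq (Op Add (Reg 2) (Const 1)) (Reg 0)) vertex_body) s
      (106 * n + 6) s' & loop_invariant (vertex_output n) n s'.
  apply: (@exec_within_while (fun i => loop_invariant (vertex_output i) i)) => [i r lti inv|r].
    split; last exact: exec_vertex_body.
    by case: inv => _ r0 _ r2 _; rewrite leqE r0 r2; lia.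
  move=> [_ r0 _ r2 _]; apply/eqP; rewrite -[_ == _]negbK leqE r0 r2; lia.
have edge_loop s : loop_invariant (prefix_output 0) 0 s -> exists2 s',
    exec_within (While (Op Leq (Op Add (Reg 2) (Const 1)) (Reg 1)) edge_body) s
      (306 * size es + 6) s' & loop_invariant (prefix_output (size es)) (size es) s'.
  apply: (@exec_within_while (fun i => loop_invariant (prefix_output i) i)) => [i r lti inv|r].
    split; last exact: exec_edge_body.
    by case: inv => _ _ r1 r2 _; rewrite leqE r1 r2; lia.
  move=> [_ _ r1 r2 _]; apply/eqP; rewrite -[_ == _]negbK leqE r1 r2; lia.
pose s0 := init_state (encode_graph es).
pose s1 := State (upd (regs s0) 0%N n%:Z) (memory s0) (out s0).
pose s2 := State (upd (regs s1) 1%N (size es)%:Z) (memory s1) (out s1).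
have ex1 : exec_within (Assign 0 (Fetch (Const 0))) s0 3 s1 := exec_within_assign _ _ _.
have ex2 : exec_within (Assign 1 (Fetch (Const 1))) s1 3 s2 := exec_within_assign _ _ _.
have [|s3 ex3 [m3 r30 r31 _ o3]] := vertex_loop s2; first by split.
pose s4 := State (upd (regs s3) 2%N 0) (memory s3) (out s3).
have ex4 : exec_within (Assign 2 (Const 0)) s3 2 s4 := exec_within_assign _ _ _.
have [|s5 ex5 [_ _ _ _ o5]] := edge_loop s4.
  by split=> //=; rewrite o3 /prefix_output take0 cats0.
have [t ex le] := exec_within_seq ex1 (exec_within_seq ex2
  (exec_within_seq ex3 (exec_within_seq ex4 ex5))).
exists t; first by exists s5 => //; rewrite o5 prefix_output_all.
by apply: leq_trans le _; lia.
Qed.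
End Execution.

Theorem theorem1 (R : realType) :
  exists (P : cmd) (Carea : R) (Ctime : nat),
  forall (n : nat) (G : sgraph n) (es : seq ('I_n * 'I_n)),
    edge_list G es ->
    exists (D : drawing n) (t : nat),
      [/\ rac_drawing R G D,
          (curve_complexity G D <= 6)%N,
          (area G D)%:~R <= Carea * (n%:R `^ (11%:R / 4%:R)),
          runs P (encode_graph es) t (encode_drawing es D)
        & (t <= Ctime * (n + #|edges G|).+1)%N].
Proof.
exists draw_program, 64, 1000%N => n G es esG.
have [t run le_t] := draw_program_runs es; exists (rect_drawing n), t; split=> //.
- exact: rect_drawing_rac.
- exact: rect_curve_complexity.
- exact: rect_area_powR.
(* Each edge is listed exactly once, so the length of the list is the number of edges. *)
- by rewrite cardE -(perm_size esG) size_map.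
Qed.
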